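(* Let $k\geq 2$ and fix any dimension vector $\beta\in\mathbb Z_{\geq 1}^k$. For $n\in\mathbb N$ let $n\beta=(n\beta_1,\ldots,n\beta_k)$. Then $$\lim_{n\to\infty}\frac{\log_2\left(\mathrm{Prob}(\mathcal N_{\mathbb B}(n\beta))\right)}{n^2}=-m(\beta),$$ where $m(\beta)=\min_{1\leq i\leq k}\beta_i\beta_{i+1}$.
   Context: Indices are taken modulo $k$. $\mathbb B=\{0,1\}$ is the Boolean semiring, where $1+1=1$. $Q$ is the cyclic quiver $1\to 2\to\cdots\to k\to 1$. For $\beta\in\mathbb Z_{\geq 0}^k$, fix free $\mathbb B$-semimodules $M_1,\ldots,M_k$ with $\mathrm{rank}\,M_i=\beta_i$ and set $\mathrm{Rep}_{\mathbb B}(Q,\beta)=\prod_{i=1}^k\mathrm{Hom}_{\mathbb B}(M_i,M_{i+1})$ (equivalently, $k$-tuples of matrices over $\mathbb B$, the $i$-th of size $\beta_{i+1}\times\beta_i$). A semirepresentation $f=(f_1,\ldots,f_k)$ is nilpotent if for each $1\leq i\leq k$ and all sufficiently large $\ell$ the composition $f_{i+\ell-1}\circ\cdots\circ f_i$ is zero; $\mathcal N_{\mathbb B}(\beta)$ is the set of nilpotent semirepresentations. $\mathrm{Prob}(\mathcal N_{\mathbb B}(\beta))=|\mathcal N_{\mathbb B}(\beta)|/|\mathrm{Rep}_{\mathbb B}(Q,\beta)|$. *)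

(* Defs.v *)
From HB Require Import structures.
From mathcomp Require Import all_boot all_order all_algebra.
From mathcomp Require Import all_classical all_reals all_analysis.

Set Implicit Arguments.
Unset Strict Implicit.
Unset Printing Implicit Defensive.
Import Order.TTheory GRing.Theory Num.Theory.
Local Open Scope ring_scope.

(* MathComp makes [bool] the two-element field (with [addb]); this alias
   carries the Boolean semiring structure instead, so that 1 + 1 = 1. *)
Definition boolsr : Type := bool.
HB.instance Definition _ := Finite.copy boolsr bool.
HB.instance Definition _ :=
  GRing.isNmodule.Build boolsr orbA orbC orFb.
HB.instance Definition _ :=
  GRing.Nmodule_isComNzSemiRing.Build boolsr
    andbA andbC andTb andb_orl andFb isT.

Section Semirepresentations.
Variables (k : nat) (beta : 'I_k -> nat).

(* Vertices are ['I_k], the arrows being i -> ordS i, where [ordS] is the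
   successor modulo k; homomorphisms of free semimodules are matrices acting
   on column vectors. *)
Definition Rep : finType :=
  {dffun forall i : 'I_k, 'M[boolsr]_(beta (ordS i), beta i)}.

(* [compose f i l] is the composition of the l arrows starting at i, i.e.
   f_(i+l-1) o ... o f_i : M_i -> M_(i+l). *)
Fixpoint compose (f : Rep) (i : 'I_k) (l : nat) :
    'M[boolsr]_(beta (iter l (@ordS k) i), beta i) :=
  if l is l'.+1 then f (iter l' (@ordS k) i) *m compose f i l' else 1%:M.

Definition nilpotent_rep (f : Rep) : Prop :=
  forall i : 'I_k, exists L : nat, forall l : nat,
    (L <= l)%N -> compose f i l = 0.

Definition nilpotents : {set Rep} := [set f : Rep | `[< nilpotent_rep f >]]%SET.

(* The maximum is only the default value of the iterated minimum; it does not
   affect the result as soon as k > 0. *)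
Definition min_prod : nat :=
  \big[minn / \max_(i < k) (beta i * beta (ordS i))%N]_(i < k)
    (beta i * beta (ordS i))%N.

End Semirepresentations.

Definition prob_nilpotent (R : realType) (k : nat) (beta : 'I_k -> nat) : R :=
  #|nilpotents beta|%:R / #|{: Rep beta}|%:R.

Definition log2 (R : realType) (x : R) : R := ln x / ln 2.

(* Main.v *)
(* A semirepresentation is a directed graph on the union of the bases of the
   M_i, and it is nilpotent iff the graph is acyclic. Killing the arrow with the
   smallest [beta i * beta (i+1)] gives the lower bound. For the upper bound, an
   acyclic graph on N vertices has a rank function r into {0, ..., N} that
   strictly increases along its arcs, and there are only (N+1)^N functions.
   Given r, choose one vertex u_i in each layer, uniformly: r cannot
   strictly increase all along the cycle u_1, ..., u_k, u_1, so the proportions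
   of non-increasing pairs between consecutive layers sum to at least 1, and
   r forbids at least min_i (beta i * beta (i+1)) arcs. *)
Require Import Defs.
From mathcomp Require Import all_boot all_order all_algebra.
From mathcomp Require Import all_classical all_reals all_analysis.
From mathcomp Require Import ring lra zify.
Import Order.TTheory GRing.Theory Num.Theory.
Import numFieldNormedType.Exports.
Local Open Scope classical_set_scope.
Local Open Scope ring_scope.

Set Implicit Arguments.
Unset Strict Implicit.
Unset Printing Implicit Defensive.

(** * Pairs along which a rank fails to increase *)

Definition inversions (A B : finType) (rA : A -> nat) (rB : B -> nat) : nat :=
  (\sum_a \sum_b (rB b <= rA a))%N.

(** If [rC c <= rA a], then for every [b] either [rB b <= rA a], or [rA a < rB b] and hence
    [rC c <= rB b]. Sum over all triples. *)
Lemma inversions_triangle (A B C : finType)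
    (rA : A -> nat) (rB : B -> nat) (rC : C -> nat) :
  (inversions rA rC * #|B| <=
   inversions rA rB * #|C| + #|A| * inversions rB rC)%N.
Proof.
have -> : (inversions rA rC * #|B| =
    \sum_a \sum_(b : B) \sum_c (rC c <= rA a)%N)%N.
  rewrite big_distrl /=; apply: eq_bigr => a _.
  by rewrite sum_nat_const mulnC.
have -> : (inversions rA rB * #|C| =
    \sum_a \sum_b \sum_(c : C) (rB b <= rA a)%N)%N.
  rewrite big_distrl /=; apply: eq_bigr => a _.
  rewrite big_distrl /=; apply: eq_bigr => b _.
  by rewrite sum_nat_const mulnC.
rewrite -[(#|A| * _)%N](@sum_nat_const A predT) -big_split /=.
apply: leq_sum => a _; rewrite -big_split /=.
apply: leq_sum => b _; rewrite -big_split /=.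
apply: leq_sum => c _.
case: (leqP (rC c) (rA a)) => // ca.
case: (leqP (rB b) (rA a)) => //= ab.
by rewrite (leq_trans ca (ltnW ab)).
Qed.

Lemma inversions_total (A B : finType) (rA : A -> nat) (rB : B -> nat) :
  (#|A| * #|B| <= inversions rA rB + inversions rB rA)%N.
Proof.
rewrite /inversions [X in (_ + X)%N]exchange_big -big_split /= -sum_nat_const.
apply: leq_sum => a _; rewrite -big_split /= -sum1_card.
by apply: leq_sum => b _; case: (leqP (rB b) (rA a)) => //= /ltnW ->.
Qed.

(** * The graph of a semirepresentation and its rank functions *)

Section Layers.
Variables (k : nat) (d : 'I_k -> nat).

Definition vertex : finType := {i : 'I_k & 'I_(d i)}.

Definition arc : finType := {i : 'I_k & ('I_(d (ordS i)) * 'I_(d i))%type}.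

(** Ranks take values in a finite type so that rank functions can be counted. *)
Definition rank_at (r : {ffun vertex -> 'I_#|vertex|.+1}) i
    (a : 'I_(d i)) : nat :=
  r (Tagged (fun i => 'I_(d i)) a).

Definition source (x : arc) : vertex := Tagged (fun i => 'I_(d i)) (tagged x).2.

Definition target (x : arc) : vertex := Tagged (fun i => 'I_(d i)) (tagged x).1.

Definition arcs (f : Rep d) : {set arc} :=
  [set x | (f (tag x) (tagged x).1 (tagged x).2 : bool)]%SET.

Definition arc_rel (f : Rep d) : rel vertex :=
  fun u v => [exists x in arcs f, (source x == u) && (target x == v)].

Definition rep_of_arcs (S : {set arc}) : Rep d :=
  [ffun i => \matrix_(c, a)
     ((Tagged (fun i => ('I_(d (ordS i)) * 'I_(d i))%type) (c, a) \in S)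
        : boolsr)].

Lemma arcsK : cancel arcs rep_of_arcs.
Proof.
move=> f; apply/ffunP => i; apply/matrixP => c a.
by rewrite ffunE mxE inE.
Qed.

Lemma rep_of_arcsK : cancel rep_of_arcs arcs.
Proof.
by move=> S; apply/setP => -[i [c a]]; rewrite inE /= ffunE mxE.
Qed.

Lemma card_Rep : #|{: Rep d}| = (2 ^ #|arc|)%N.
Proof.
rewrite -[in RHS]cardsT -card_powerset -[LHS](card_imset _ (can_inj arcsK)).
apply: eq_card => S; rewrite powersetE finset.subsetT.
by apply/imsetP; exists (rep_of_arcs S); rewrite ?rep_of_arcsK.
Qed.

Lemma card_arcs_subset (A : {set arc}) :
  #|[set f : Rep d | arcs f \subset A]%SET| = (2 ^ #|A|)%N.
Proof.
rewrite -card_powerset -(card_imset _ (can_inj arcsK)).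
apply: eq_card => S; rewrite powersetE; apply/imsetP/idP.
  by case=> f; rewrite inE => ? ->.
by move=> SA; exists (rep_of_arcs S); rewrite ?inE ?rep_of_arcsK.
Qed.

(** Nothing cancels in [boolsr]: one true term makes the whole sum true, so a single walk already
    forces an entry of the composition. *)
Lemma path_compose (f : Rep d) (i : 'I_k) (a : 'I_(d i)) (p : seq vertex) :
  path (arc_rel f) (Tagged (fun i => 'I_(d i)) a) p ->
  exists c, last (Tagged (fun i => 'I_(d i)) a) p
            = Tagged (fun i => 'I_(d i)) c
         /\ compose f i (size p) c a = (true : boolsr).
Proof.
elim/last_ind: p => [_|p v IH].
  by exists a; split=> //=; rewrite mxE eqxx.
rewrite rcons_path last_rcons size_rcons => /andP[/IH[b [-> Cb]]].
case/existsP=> -[j [c b']]; rewrite inE /= => /and3P[fx /eqP sx /eqP <-].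
(* The layers must be identified first; only then can [eq_Tagged] compare the basis elements. *)
have ji : j = iter (size p) (@ordS k) i by case: (congr1 tag sx).
move: b' c fx sx; rewrite ji => b' c fx.
move/eqP; rewrite eq_Tagged /= => /eqP bb; rewrite bb in fx.
exists c; split=> //=; rewrite mxE (bigD1 b) //= Cb.
by rewrite [f _ c b]fx.
Qed.

Lemma nilpotent_acyclic (f : Rep d) (v : vertex) (p : seq vertex) :
  nilpotent_rep f -> path (arc_rel f) v p -> last v p = v -> p = [::].
Proof.
case: v => i a nf vp pv; case: p => // w p in vp pv *.
have [L hL] := nf i.
(* Going [L] times around the closed walk gives a walk of length at least [L], where compositions
   vanish. *)
pose q := iter L (cat (w :: p)) [::].
have [vq _] : path (arc_rel f) (existT _ i a) q /\
    last (existT _ i a) q = existT _ i a.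
  rewrite /q; elim: (L) => [//|l [IH1 IH2]].
  by rewrite iterS cat_path last_cat vp pv.
have sq : (L <= size q)%N.
  rewrite /q; elim: (L) => // l IH.
  by rewrite iterS size_cat /= addSn ltnS (leq_trans IH) ?leq_addl.
have [c [_]] := path_compose vq.
by rewrite hL // mxE.
Qed.

Definition monotone_arcs (r : {ffun vertex -> 'I_#|vertex|.+1}) : {set arc} :=
  [set x | r (source x) < r (target x)]%N%SET.

Lemma nilpotent_rank (f : Rep d) :
  nilpotent_rep f -> exists r, arcs f \subset monotone_arcs r.
Proof.
move=> nf.
pose anc v := [set w | connect (arc_rel f) w v]%SET.
(* The rank of a vertex is its number of ancestors, itself included; this is at most [#|vertex|], so
   [inord] does not truncate. *)
exists [ffun v => inord #|anc v|].
apply/fintype.subsetP => x fx; rewrite inE !ffunE !inordK ?ltnS ?max_card //.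
have st : arc_rel f (source x) (target x).
  by apply/existsP; exists x; rewrite fx !eqxx.
apply: proper_card; apply/properP; split.
  apply/fintype.subsetP => w; rewrite !inE => /connect_trans; apply.
  exact: connect1.
(* The target is its own ancestor; were it an ancestor of the source, [x] would close a cycle. *)
exists (target x); rewrite inE ?connect0 //.
apply/negP => /connectP[p tp sp].
have := @nilpotent_acyclic f (target x) (rcons p (target x)) nf.
rewrite rcons_path tp -sp st last_rcons => /(_ isT erefl).
by case: (p).
Qed.

Lemma card_nonmonotone (r : {ffun vertex -> 'I_#|vertex|.+1}) :
  #|~: monotone_arcs r|%SET =
  (\sum_i inversions (rank_at r (i:=i)) (rank_at r (i:=ordS i)))%N.
Proof.
rewrite -sum1_card big_mkcond /=.
transitivity (\sum_(x : arc) (r (target x) <= r (source x)) : nat)%N.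
  by apply: eq_bigr => x _; rewrite !inE -leqNgt; case: leqP.
rewrite /inversions.
under [RHS]eq_bigr => i _ do rewrite exchange_big pair_big /=.
by rewrite sig_big_dep /=; apply: eq_bigr.
Qed.
End Layers.

(** * Densities of non-increasing pairs around the cycle *)

Section CyclicInversions.
Variables (k : nat) (d : 'I_k -> nat) (r : forall i, 'I_(d i) -> nat).
Hypotheses (hk : (2 <= k)%N) (d_gt0 : forall i, (0 < d i)%N).

(** The probability that [r] does not increase from a uniform vertex of layer [i] to an independent
    one of layer [j]. *)
Let p i j : rat := (inversions (@r i) (@r j))%:R / (d i * d j)%:R.

Lemma inversion_density_triangle i j l : p i l <= p i j + p j l.
Proof.
have := inversions_triangle (@r i) (@r j) (@r l).
rewrite !card_ord -(ler_nat rat) natrD !natrM => h.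
have [di dj dl] : [/\ 0 < (d i)%:R :> rat, 0 < (d j)%:R :> rat
  & 0 < (d l)%:R :> rat] by rewrite !ltr0n !d_gt0.
rewrite /p !natrM -(ler_pM2r (mulr_gt0 (mulr_gt0 di dj) dl)).
apply: le_trans (le_trans _ h) _; rewrite le_eqVlt; apply/orP; left; apply/eqP.
  by field; rewrite !gt_eqF.
by field; rewrite !gt_eqF.
Qed.

Lemma inversion_density_total i j : 1 <= p i j + p j i.
Proof.
have := inversions_total (@r i) (@r j).
rewrite !card_ord -(ler_nat rat) natrD => h.
have dd : 0 < (d i * d j)%:R :> rat by rewrite ltr0n muln_gt0 !d_gt0.
by rewrite /p [X in _ / X%:R]mulnC (mulnC (d j)) -mulrDl ler_pdivlMr // mul1r.
Qed.

Lemma inversion_density_path (q : nat -> 'I_k) n :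
  p (q 0%N) (q n.+1) <= \sum_(l < n.+1) p (q l) (q l.+1).
Proof.
elim: n => [|n IH]; first by rewrite big_ord1.
rewrite big_ord_recr /=.
by apply: le_trans (inversion_density_triangle _ (q n.+1) _) _; rewrite lerD2r.
Qed.

(** The path through all layers bounds the density from first to last; the closing arrow gives the
    reverse density, and the two add up to at least 1. *)
Lemma inversion_density_cycle : 1 <= \sum_i p i (ordS i).
Proof.
case: k hk p inversion_density_path inversion_density_total
  => [|[|n]] // _ f fP fT.
(* Here k is [n.+2], and layers are indexed periodically by naturals. *)
pose q (l : nat) : 'I_n.+2 := inord (l %% n.+2).
have qS l : q l.+1 = ordS (q l).
  by apply: val_inj; rewrite /= !inordK ?ltn_mod // -addn1 -modnDml addn1.
have -> : \sum_i f i (ordS i) = \sum_(l < n.+2) f (q l) (q l.+1).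
  by apply: eq_bigr => i _; rewrite qS /q modn_small // inord_val.
rewrite big_ord_recr /=.
have -> : q n.+2 = q 0%N by rewrite /q modnn mod0n.
by apply: le_trans (fT (q 0%N) (q n.+1)) _; rewrite lerD2r.
Qed.

Lemma inversions_cycle m : (forall i, (m <= d i * d (ordS i))%N) ->
  (m <= \sum_i inversions (@r i) (@r (ordS i)))%N.
Proof.
move=> hm; rewrite -(ler_nat rat) natr_sum.
apply: le_trans (_ : m%:R * \sum_i p i (ordS i) <= _).
  by rewrite ler_peMr // inversion_density_cycle.
rewrite mulr_sumr; apply: ler_sum => i _.
have dd : 0 < (d i * d (ordS i))%:R :> rat by rewrite ltr0n muln_gt0 !d_gt0.
by rewrite /p mulrCA ler_piMr // ler_pdivrMr // mul1r ler_nat.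
Qed.
End CyclicInversions.

(** * Upper and lower bounds on the number of nilpotents *)

Section Counting.
Variables (k : nat) (d : 'I_k -> nat).

(** Union bound over rank functions: each one forbids at least [m] arcs, leaving at most a fraction
    [2 ^ - m] of all semirepresentations. *)
Lemma card_nilpotents_le m : (2 <= k)%N -> (forall i, 0 < d i)%N ->
  (forall i, (m <= d i * d (ordS i))%N) ->
  (#|nilpotents d| * 2 ^ m <=
   #|vertex d|.+1 ^ #|vertex d| * #|{: Rep d}|)%N.
Proof.
move=> hk d_gt0 hm.
have le_sum : (#|nilpotents d| <=
    \sum_r #|[set f : Rep d | arcs f \subset monotone_arcs r]%SET|)%N.
  under eq_bigr do rewrite -sum1_card big_mkcond.
  rewrite exchange_big -sum1_card big_mkcond /=; apply: leq_sum => f _.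
  case: ifP => //; rewrite inE => /asboolP /nilpotent_rank[r fr].
  by rewrite (bigD1 r) //= inE fr.
apply: leq_trans (leq_mul le_sum (leqnn _)) _.
have <- : #|{: {ffun vertex d -> 'I_#|vertex d|.+1}}| =
    (#|vertex d|.+1 ^ #|vertex d|)%N by rewrite card_ffun card_ord.
rewrite big_distrl -sum_nat_const.
apply: leq_sum => r _.
rewrite /= card_arcs_subset card_Rep -expnD leq_exp2l //.
rewrite -(finset.cardsC (monotone_arcs r)) leq_add2l card_nonmonotone.
exact: inversions_cycle.
Qed.

Lemma zero_arrow_nilpotent (f : Rep d) (i : 'I_k) :
  f i = 0 -> nilpotent_rep f.
Proof.
move=> fi0 j.
have [l jl] : exists l, iter l (@ordS k) j = i.
  (* Adding k keeps the truncated subtraction exact, since [j < k]. *)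
  exists (i + (k - j))%N; apply: val_inj.
  have -> n : val (iter n (@ordS k) j) = ((j + n) %% k)%N.
    elim: n => [|n IH]; first by rewrite addn0 modn_small.
    by rewrite iterS /= IH -addn1 modnDml addn1 addnS.
  by rewrite addnCA subnKC 1?ltnW // modnDr modn_small.
exists l.+1; elim=> // n IH.
rewrite leq_eqVlt => /predU1P[[<-]|/IH /= ->]; last by rewrite mulmx0.
have fl : f (iter l (@ordS k) j) = 0 by rewrite jl.
by rewrite /= fl mul0mx.
Qed.

(** With arrow [i] set to zero, all arcs outside layer [i] remain free. *)
Lemma card_Rep_le i :
  (#|{: Rep d}| <= #|nilpotents d| * 2 ^ (d i * d (ordS i)))%N.
Proof.
pose A : {set arc d} := [set x | tag x == i]%SET.
have cA : (#|A| <= d i * d (ordS i))%N.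
  have -> : (d i * d (ordS i) = #|{: 'I_(d (ordS i)) * 'I_(d i)}|)%N.
    by rewrite card_prod !card_ord mulnC.
  pose g ca : arc d := Tagged (fun i => ('I_(d (ordS i)) * 'I_(d i))%type) ca.
  apply: leq_trans (leq_imset_card (g i) predT).
  apply/subset_leq_card/fintype.subsetP => -[j ca]; rewrite inE /= => /eqP ji.
  by move: ca; rewrite ji => ca; apply/imsetP; exists ca.
have sub : [set f : Rep d | arcs f \subset ~: A]%SET \subset nilpotents d.
  apply/fintype.subsetP => f; rewrite !inE => /fintype.subsetP fA.
  apply: (@zero_arrow_nilpotent _ i).
  apply/matrixP => c a; rewrite mxE.
  apply: (@negbTE (f i c a)); apply/negP => fca.
  have := fA (Tagged (fun i => ('I_(d (ordS i)) * 'I_(d i))%type) (c, a)).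
  by rewrite !inE /= eqxx => /(_ fca).
apply: leq_trans (leq_mul (subset_leq_card sub) (leqnn _)).
rewrite card_arcs_subset card_Rep -expnD leq_exp2l //.
by rewrite -(finset.cardsC A) addnC leq_add2l.
Qed.

Lemma card_vertex : #|vertex d| = (\sum_i d i)%N.
Proof.
rewrite card_tagged sumnE big_map big_enum.
by under eq_bigr do rewrite card_ord.
Qed.
End Counting.

(** * The minimal product, logarithmic estimates and the limit *)

Lemma min_prod_le k (beta : 'I_k -> nat) i :
  (min_prod beta <= beta i * beta (ordS i))%N.
Proof.
have := @bigmin_le _ _ _ (\max_(i < k) (beta i * beta (ordS i)))%N i
  (fun i => beta i * beta (ordS i))%N.
by rewrite leEnat; apply: leq_trans; rewrite /min_prod eq_leq.
Qed.

Lemma min_prod_attained k (beta : 'I_k -> nat) : (0 < k)%N ->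
  exists i, min_prod beta = (beta i * beta (ordS i))%N.
Proof.
move=> k0; apply: (big_ind (fun m => exists i, m = _)) => [|x y|i _].
(* The default value is a maximum, itself attained because [0 < k]. *)
- have [|i ->] := @bigop.eq_bigmax _ (fun i => beta i * beta (ordS i))%N.
    by rewrite card_ord.
  by exists i.
- by move=> [i ->] [j ->]; case: leqP => _; [exists i | exists j].
- by exists i.
Qed.

Lemma cvg_ln_affine_div (R : realType) (s : nat) :
  (fun n : nat => ln (n.+1 * s).+1%:R / n.+1%:R : R) @ \oo --> (0 : R).
Proof.
(* This bound comes from [ln x <= 2 * sqrt x] and [(n+1)s + 1 <= (s+1)(n+1)]. *)
pose h (n : nat) : R := 2 * Num.sqrt s.+1%:R * Num.sqrt (harmonic n).
have hcvg : h @ \oo --> (0 : R).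
  rewrite -[X in _ --> X](mulr0 (2 * Num.sqrt s.+1%:R)).
  apply: cvgMr; rewrite -[X in _ --> X]sqrtr0.
  exact: (cvg_comp _ _ cvg_harmonic (@sqrt_continuous R 0)).
apply: (squeeze_cvgr _ (cvg_cst 0) hcvg).
near=> n; apply/andP; split.
  by rewrite divr_ge0 // ln_ge0 // ler1n.
have n0 : 0 < n.+1%:R :> R by rewrite ltr0n.
have le_ln_sqrt (x : R) : 0 < x -> ln x <= 2 * Num.sqrt x.
  move=> x0; rewrite -{1}(sqr_sqrtr (ltW x0)) lnXn ?sqrtr_gt0 // mulr2n mulrDl.
  have le_sqrt : ln (Num.sqrt x) <= Num.sqrt x.
    have sx : 0 < Num.sqrt x by rewrite sqrtr_gt0.
    have -> : Num.sqrt x = 1 + (Num.sqrt x - 1) by ring.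
    by apply: le_trans (le_ln1Dx _) _; lra.
  by rewrite !mul1r lerD.
rewrite ler_pdivrMr //; apply: le_trans (le_ln_sqrt _ _) _.
  by rewrite ltr0n.
rewrite /h -!mulrA ler_pM2l //.
have -> : Num.sqrt (harmonic n) * n.+1%:R = Num.sqrt n.+1%:R :> R.
  rewrite /harmonic sqrtrV ?ler0n //.
  rewrite -[X in _ * X](@sqr_sqrtr _ n.+1%:R) ?ler0n //.
  by rewrite expr2 mulKf // gt_eqF // sqrtr_gt0.
rewrite -sqrtrM ?ler0n // -natrM ler_sqrt ?ler0n // ler_nat; lia.
Unshelve. all: by end_near.
Qed.

(** Logarithms of the two counting bounds; the extra term is the cost of the union bound over rank
    functions. *)
Lemma log2_prob_nilpotent_bounds (R : realType) (k : nat) (d : 'I_k -> nat)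
    (m : nat) : (2 <= k)%N -> (forall i, (0 < d i)%N) ->
  (forall i, (m <= d i * d (ordS i))%N) ->
  (exists i, m = (d i * d (ordS i))%N) ->
  - m%:R <= log2 (prob_nilpotent R d) <=
  - m%:R + #|vertex d|%:R * log2 #|vertex d|.+1%:R.
Proof.
move=> hk d0 mle [i mi].
have lo := card_Rep_le d i; rewrite -mi in lo.
have up := card_nilpotents_le hk d0 mle.
have T0 : (0 < #|{: Rep d}|)%N by rewrite card_Rep expn_gt0.
have A0 : (0 < #|nilpotents d|)%N.
  by move: lo; case: #|nilpotents d| => //; rewrite mul0n leqNgt T0.
have lnS (x y : nat) : (0 < x)%N -> (0 < y)%N -> (x <= y)%N ->
  ln x%:R <= ln y%:R :> R by move=> *; rewrite ler_ln ?posrE ?ltr0n // ler_nat.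
have lnMn (x y : nat) : (0 < x)%N -> (0 < y)%N ->
  ln (x * y)%:R = ln x%:R + ln y%:R :> R.
  by move=> *; rewrite natrM lnM // posrE ltr0n.
have lnXn' (x n : nat) : (0 < x)%N -> ln (x ^ n)%:R = n%:R * ln x%:R :> R.
  by move=> *; rewrite natrX lnXn ?ltr0n // mulr_natl.
have {}lo : ln #|{: Rep d}|%:R <= ln #|nilpotents d|%:R + m%:R * ln 2 :> R.
  by rewrite -lnXn' // -lnMn ?expn_gt0 // lnS // muln_gt0 A0 expn_gt0.
have {}up : ln #|nilpotents d|%:R + m%:R * ln 2 <=
    #|vertex d|%:R * ln #|vertex d|.+1%:R + ln #|{: Rep d}|%:R :> R.
  rewrite -!lnXn' // -!lnMn ?expn_gt0 // lnS // muln_gt0 ?A0 ?T0 expn_gt0 //.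
have l2 : 0 < ln 2 :> R by rewrite ln_gt0 // ltr1n.
rewrite /log2 /prob_nilpotent ln_div ?posrE ?ltr0n //.
rewrite mulrA -[- m%:R](mulfK (lt0r_neq0 l2)) -mulrDl !ler_pM2r ?invr_gt0 //.
by apply/andP; split; lra.
Qed.

Theorem corollary4p7 (R : realType) (k : nat) (hk : (2 <= k)%N)
  (beta : 'I_k -> nat) (hbeta : forall i : 'I_k, (1 <= beta i)%N) :
  (fun n : nat =>
     log2 (prob_nilpotent R (fun i : 'I_k => (n * beta i)%N)) / n%:R ^+ 2)
    @ \oo --> (- (min_prod beta)%:R : R).
Proof.
(* Shifting to [n.+1] avoids the division by zero at [n = 0]. *)
rewrite -cvg_shiftS.
set m := min_prod beta; pose s := (\sum_i beta i)%N.
(* This is [N * log2 (N+1) / (n+1)^2] for the vertex count [N = (n+1)s]. *)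
pose err (n : nat) : R := s%:R / ln 2 * (ln (n.+1 * s).+1%:R / n.+1%:R).
have err_cvg : (fun n => - m%:R + err n) @ \oo --> (- m%:R : R).
  rewrite -[X in _ --> X]addr0; apply: cvgD; first exact: cvg_cst.
  rewrite -[X in _ --> X](mulr0 (s%:R / ln 2)).
  by apply: cvgMr; exact: cvg_ln_affine_div.
apply: (squeeze_cvgr _ (@cvg_cst R (- m%:R) _ _ _) err_cvg).
near=> n; rewrite /=.
pose d (i : 'I_k) := (n.+1 * beta i)%N.
have dd i : (d i * d (ordS i) = n.+1 ^ 2 * (beta i * beta (ordS i)))%N.
  by rewrite /d mulnACA mulnn.
have d_gt0 i : (0 < d i)%N by rewrite muln_gt0 hbeta.
have mle i : (n.+1 ^ 2 * m <= d i * d (ordS i))%N.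
  by rewrite dd leq_mul2l min_prod_le orbT.
have mex : exists i, (n.+1 ^ 2 * m)%N = (d i * d (ordS i))%N.
  have [|i mi] := @min_prod_attained k beta; first exact: ltnW.
  by exists i; rewrite dd -mi.
have := log2_prob_nilpotent_bounds R hk d_gt0 mle mex.
rewrite card_vertex -big_distrr /= -/s => /andP[lo up].
have n0 : 0 < n.+1%:R :> R by rewrite ltr0n.
rewrite ler_pdivlMr ?exprn_gt0 // ler_pdivrMr ?exprn_gt0 //.
have l2 : ln 2 != 0 :> R by rewrite gt_eqF // ln_gt0 // ltr1n.
apply/andP; split.
  by apply: le_trans lo; rewrite (natrM _ (n.+1 ^ 2)) natrX mulrC mulrN.
apply: (le_trans up); rewrite /err /log2 (natrM _ (n.+1 ^ 2)) natrX.
rewrite le_eqVlt; apply/orP; left; apply/eqP.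
by field; rewrite l2 gt_eqF.
Unshelve. all: by end_near.
Qed.
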